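(* Let $q,r$ be positive integers with $q\ge 2$, and let $n=2^{\frac{r(r+1)}{2}-1}q$. Then there exists a $2^r$-regular $(n,n,Z_r,S_r)$ PDA, where $Z_r$ and $S_r$ are given by the recursive relations $$Z_1=1,\qquad Z_i=(2^i-2)Z_{i-1}+n_{i-1},$$ $$S_1=\frac{q(q-1)}{2},\qquad S_i=\frac{2^i(2^i-1)}{2}S_{i-1}+n_{i-1}Z_{i-1},$$ for $i\ge 2$, with $n_i=2^{\frac{i(i+1)}{2}-1}q$.
   Context: Notation: $[n]=\{0,1,\dots,n-1\}$. For positive integers $K,f$, a nonnegative integer $Z$ and a finite set $\mathcal{S}$ of integers, a $(K,f,Z,\mathcal{S})$ placement delivery array (PDA) is an $f\times K$ array $P=[p_{j,k}]$, $j\in[f]$, $k\in[K]$, with entries in $\mathcal{S}\cup\{\ast\}$ such that: (C1) $\ast$ appears exactly $Z$ times in each column; (C2) each $s\in\mathcal{S}$ occurs at least once; (C3, Blackburn property) if two distinct cells $(j_1,k_1)$, $(j_2,k_2)$ contain the same integer then $p_{j_1,k_2}=p_{j_2,k_1}=\ast$. It is $g$-regular if each integer of $\mathcal{S}$ occurs exactly $g$ times. A $(K,f,Z,S)$ PDA with $S$ a nonnegative integer is a $(K,f,Z,\mathcal{S})$ PDA with $\mathcal{S}=\{0,1,\dots,S-1\}$. *)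

(* Defs.v *)
From mathcomp Require Import all_boot all_order all_algebra.
From mathcomp Require Import finmap.

Set Implicit Arguments.
Unset Strict Implicit.
Unset Printing Implicit Defensive.

(* Rows are indexed by f, columns by K (a PDA is listed as K, f, Z, S);
   the star is None and the integer s is Some s. *)
Definition array (f K : nat) := 'M[option int]_(f, K).

Definition occurrences (f K : nat) (P : array f K) (s : int) : nat :=
  #|[set c : 'I_f * 'I_K | P c.1 c.2 == Some s]|.

Record is_PDA (K f Z : nat) (S : {fset int}) (P : array f K) : Prop := IsPDA {
  PDA_cols_gt0 : 0 < K;
  PDA_rows_gt0 : 0 < f;
  PDA_entries : forall j k s, P j k = Some s -> s \in S;
  PDA_stars : forall k, #|[set j | P j k == None]| = Z;
  PDA_occurs : forall s, s \in S -> exists j k, P j k = Some s;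
  PDA_Blackburn : forall j1 k1 j2 k2 s, (j1, k1) <> (j2, k2) ->
    P j1 k1 = Some s -> P j2 k2 = Some s ->
    P j1 k2 = None /\ P j2 k1 = None
}.

Definition regular (f K g : nat) (S : {fset int}) (P : array f K) : Prop :=
  forall s, s \in S -> occurrences P s = g.

Definition symbols (m : nat) : {fset int} :=
  [fset Posz i | i in iota 0 m]%fset.

Definition exists_regular_PDA (g K f Z m : nat) : Prop :=
  exists P : array f K, is_PDA Z (symbols m) P /\ regular g (symbols m) P.

(* For i >= 1 all halvings and subtractions below are exact in nat. *)
Definition n_ (q i : nat) : nat := 2 ^ ((i * (i + 1)) %/ 2 - 1) * q.

(* Z_ and S_ are meaningful from index 1 on; the value at 0 is a dummy one,
   which the recursion never uses. *)
Fixpoint Z_ (q i : nat) : nat :=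
  match i with
  | 0 => 0
  | 1 => 1
  | j.+1 => (2 ^ i - 2) * Z_ q j + n_ q j
  end.

Fixpoint S_ (q i : nat) : nat :=
  match i with
  | 0 => 0
  | 1 => (q * (q - 1)) %/ 2
  | j.+1 => (2 ^ i * (2 ^ i - 1)) %/ 2 * S_ q j + n_ q j * Z_ q j
  end.

(* Main.v *)
(** A [g]-regular [n * n] PDA is lifted by replacing each of its cells with
    an [m * m] block, [m = 2g].  A star becomes a block with one new symbol on the
    diagonal and stars elsewhere: a new symbol occurs once in each of [m]
    positions.  The [g] cells holding a symbol [s] become blocks with stars exactly
    on the diagonal, whose off-diagonal cells are filled symmetrically along a
    1-factorization of the complete graph on [m] vertices: for each of the [m - 1]
    perfect matchings there are [g] symbols, and each of them distributes the [g]
    edges of the matching bijectively over the [g] blocks, occurring at the two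
    cells of each edge.  Disjointness of the edges of a matching is the Blackburn
    property across blocks.  The 1-factorization is that of an elementary abelian
    2-group, where the matchings are the nonzero differences.  The starting point
    is the symmetric [q * q] array with stars on the diagonal. *)

Require Import Defs.
From HB Require Import structures.
From mathcomp Require Import all_boot all_order all_algebra.
From mathcomp Require Import finmap.
From mathcomp Require Import zify.

Set Implicit Arguments.
Unset Strict Implicit.
Unset Printing Implicit Defensive.

Import GRing.Theory.

(** Lets the product be inferred as a [finZmodType], so that [C * bool] can replace [C] in the
    induction. *)
HB.instance Definition _ (C D : finZmodType) := GRing.Zmodule.on (C * D)%type.

(* A [#|C|]-regular PDA given by its occurrences: the cell
   [(row s c, col s c)] is the [c]-th occurrence of the symbol [s]. *)
Record occurrence_system (J K S C : finType) (Z : nat)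
    (row : S -> C -> J) (col : S -> C -> K) (star : J -> K -> bool) : Prop :=
  OccurrenceSystem {
  occ_inj : forall s c s' c',
    row s c = row s' c' -> col s c = col s' c' -> s = s' /\ c = c';
  occ_nonstar : forall s c, ~~ star (row s c) (col s c);
  nonstar_occ : forall j k, ~~ star j k -> exists s c, row s c = j /\ col s c = k;
  occ_blackburn : forall s c c', c != c' -> star (row s c) (col s c');
  occ_stars : forall k, #|[set j | star j k]| = Z
}.

(** * From occurrence systems to PDAs *)

Section ToPDA.
Variables (J K S C : finType) (Z : nat).
Variables (row : S -> C -> J) (col : S -> C -> K) (star : J -> K -> bool).
Hypothesis sys : occurrence_system Z row col star.

Definition occ_array : array #|J| #|K| := (\matrix_(a, b)
  omap (fun p : S * C => Posz (enum_rank p.1))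
    [pick p : S * C |
      (row p.1 p.2 == enum_val a) && (col p.1 p.2 == enum_val b)])%R.

(** By [occ_inj] at most one pair qualifies for the pick, so no choice is involved. *)
Lemma occ_array_Some a b z : occ_array a b = Some z <->
  exists s c, [/\ z = Posz (enum_rank s), row s c = enum_val a
                & col s c = enum_val b].
Proof.
rewrite mxE; case: pickP => [[s c] /= /andP[/eqP ra /eqP cb]|none] /=.
  split=> [[<-]|[s' [c' [-> ra' cb']]]]; first by exists s, c.
  by have [|| -> _] := occ_inj sys (s := s) (c := c) (s' := s') (c' := c');
    rewrite ?ra ?cb.
split=> // -[s [c [_ ra cb]]].
by have := none (s, c); rewrite /= ra cb !eqxx.
Qed.

Lemma occ_array_None a b :
  (occ_array a b == None) = star (enum_val a) (enum_val b).
Proof.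
case E: (occ_array a b) => [z|] /=.
  have [s [c [_ <- <-]]] := (occ_array_Some a b z).1 E.
  exact/esym/negbTE/(occ_nonstar sys).
apply/esym; apply: contraT => /(nonstar_occ sys)[s [c [ra cb]]].
have : occ_array a b = Some (Posz (enum_rank s)).
  by apply/occ_array_Some; exists s, c.
by rewrite E.
Qed.

Lemma mem_symbols m (i : nat) : (Posz i \in symbols m) = (i < m).
Proof.
apply/imfsetP/idP => [[j /=]|im]; first by rewrite mem_iota => /andP[_ ?] [->].
by exists i => //=; rewrite mem_iota.
Qed.

Lemma symbols_rank z : z \in symbols #|S| -> exists s : S, z = Posz (enum_rank s).
Proof.
case/imfsetP => i /=; rewrite mem_iota add0n => /= im ->.
by exists (enum_val (Ordinal im)); rewrite enum_valK.
Qed.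

Lemma occurrence_system_PDA : 0 < #|J| -> 0 < #|K| -> 0 < #|C| ->
  exists_regular_PDA #|C| #|K| #|J| Z #|S|.
Proof.
move=> J0 K0 C0; exists occ_array; split; first split=> //.
- move=> a b z /occ_array_Some[s [c [-> _ _]]].
  by rewrite mem_symbols ltn_ord.
- move=> b; rewrite -(occ_stars sys (enum_val b)) -(card_imset _ enum_val_inj).
  apply: eq_card => j; rewrite inE; apply/imsetP/idP => [[a]|sj].
    by rewrite inE occ_array_None => ? ->.
  by exists (enum_rank j); rewrite ?inE ?occ_array_None enum_rankK.
- move=> z /symbols_rank[s ->]; have /card_gt0P[c _] := C0.
  exists (enum_rank (row s c)), (enum_rank (col s c)).
  by apply/occ_array_Some; exists s, c; rewrite !enum_rankK.
- move=> a b a' b' z ab /occ_array_Some[s [c [-> ra cb]]].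
  move=> /occ_array_Some[s' [c' [[/ord_inj/enum_rank_inj<-] ra' cb']]].
  have cc' : c != c'.
    apply/eqP => E; apply: ab; move: ra' cb'; rewrite -E ra cb.
    by move=> /enum_val_inj-> /enum_val_inj->.
  split; apply/eqP; rewrite occ_array_None -?ra -?cb -?ra' -?cb'.
    exact: occ_blackburn sys _ _ _ cc'.
  by apply: occ_blackburn sys _ _ _ _; rewrite eq_sym.
- move=> z /symbols_rank[s ->]; rewrite /occurrences.
  pose h c := (enum_rank (row s c), enum_rank (col s c)).
  have hinj : injective h.
    by move=> c c' [/enum_rank_inj ? /enum_rank_inj ?];
      have [] := occ_inj sys (s := s) (c := c) (s' := s) (c' := c').
  rewrite -(card_codom hinj); apply: eq_card => -[a b]; rewrite inE /=.
  apply/eqP/codomP => [/occ_array_Some|[c [-> ->]]].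
    move=> [s' [c [[/ord_inj/enum_rank_inj<-] ra cb]]].
    by exists c; rewrite /h ra cb !enum_valK.
  by apply/occ_array_Some; exists s, c; rewrite !enum_rankK.
Qed.

Lemma card_star_cells : #|{: {p : J * K | star p.1 p.2}}| = #|K| * Z.
Proof.
rewrite card_sig -sum1_card.
rewrite (eq_bigl (fun p : J * K => star p.1 p.2)) //.
rewrite -(pair_big_dep xpredT star (fun _ _ => 1)) /=.
rewrite (exchange_big_dep xpredT) //= -sum_nat_const.
apply: eq_bigr => k _; rewrite sum1_card -(occ_stars sys k).
by apply: eq_card => j; rewrite inE.
Qed.

End ToPDA.

(** * Matchings of an elementary abelian 2-group *)

Section Edges.
Local Open Scope ring_scope.
Variable C : finZmodType.
Hypothesis C2 : forall x : C, x + x = 0.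
Implicit Types (d : C * bool) (t : C) (b : bool).

(* For [d.2 = false] the matching of difference [d] has two edges over each
   coset of [<d.1>], one in each copy of [C]; comparing ranks singles out one
   point of the coset, and thereby assigns the two edges to its two points. *)
Definition edge_copy d t : bool :=
  ~~ d.2 && (enum_rank t < enum_rank (t + d.1)%R)%N.

(** The labels [t] in [C] index the edges [{x, x + d}] of the matching of difference [d]; [b]
    selects an endpoint. *)
Definition edge_end d t b : C * bool := (t, edge_copy d t) + (if b then d else 0).

Lemma prod_char2 (x : C * bool) : x + x = 0.
Proof. by case: x => x b; congr pair; [exact: C2|exact: addbb]. Qed.

Lemma add_eq0_char2 (x y : C * bool) : (x + y == 0) = (x == y).
Proof. by rewrite -(inj_eq (addIr y)) -addrA prod_char2 addr0 add0r. Qed.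

Lemma edge_end_negb d t b : edge_end d t (~~ b) = edge_end d t b + d.
Proof.
by rewrite /edge_end; case: b; rewrite /= -?addrA ?prod_char2 ?addr0 ?add0r.
Qed.

(** If [d.2] holds, both copies are [false]. Otherwise [d.1] is nonzero and the two rank comparisons
    are opposite, so the copies differ. *)
Lemma edge_copy_neq d t : d != 0 -> edge_copy d t (+) edge_copy d (t + d.1) = d.2 ->
  False.
Proof.
case: d => a [] /= d0; rewrite /edge_copy //= -addrA C2 addr0.
have : enum_rank t != enum_rank (t + a).
  apply: contra d0 => /eqP/enum_rank_inj E; apply/eqP; congr pair.
  by apply: (addrI t); rewrite addr0 -E.
by rewrite -val_eqE /=; case: ltngtP.
Qed.

Lemma edge_end_inj d t b t' b' : d != 0 ->
  edge_end d t b = edge_end d t' b' -> t = t' /\ b = b'.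
Proof.
(* Opposite ends can only meet when [v = u + d.1], which [edge_copy_neq] excludes. *)
move=> d0; have opp u v : edge_end d u true = edge_end d v false -> False.
  rewrite /edge_end addr0 => -[uv /= w]; apply: (edge_copy_neq (t := u) d0).
  rewrite -[_ + d.1]/(u + d.1) uv -w.
  by rewrite -[(_ + _)%R]/(edge_copy d u (+) d.2) addbA addbb.
by case: b b' => -[] E; [case/addIr: E|case: (opp _ _ E)|
  case: (opp _ _ (esym E))|case/addIr: E].
Qed.

Lemma edge_end_surj d x : d != 0 -> exists t b, edge_end d t b = x.
Proof.
move=> d0; pose h (p : C * bool) := edge_end d p.1 p.2.
have hinj : injective h by move=> [t b] [t' b'] /(edge_end_inj d0) /= [-> ->].
by have /codomP[[t b] ->] := inj_card_onto hinj (leqnn _) x; exists t, b.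
Qed.

End Edges.

(** * The lifting step *)

Section Lift.
Local Open Scope ring_scope.
Variables (J K S : finType) (C : finZmodType) (Z : nat).
Variables (row : S -> C -> J) (col : S -> C -> K) (star : J -> K -> bool).
Hypothesis C2 : forall x : C, x + x = 0.
Hypothesis sys : occurrence_system Z row col star.

Definition lift_symbol : finType :=
  ((S * {d : C * bool | d != 0} * C) + {p : J * K | star p.1 p.2})%type.

(** In block [c], the symbol [(s0, d, t)] takes the edge labelled [t + c]: for fixed [t] this is a
    bijection from blocks to edges, and for a fixed block one from symbols to edges. *)
Definition lift_row (s : lift_symbol) (v : C * bool) : J * (C * bool) :=
  match s with
  | inl (s0, d, t) => (row s0 v.1, edge_end (val d) (t + v.1) v.2)
  | inr p => ((val p).1, v)
  end.

Definition lift_col (s : lift_symbol) (v : C * bool) : K * (C * bool) :=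
  match s with
  | inl (s0, d, t) => (col s0 v.1, edge_end (val d) (t + v.1) (~~ v.2))
  | inr p => ((val p).2, v)
  end.

Definition lift_star (j : J * (C * bool)) (k : K * (C * bool)) : bool :=
  star j.1 k.1 (+) (j.2 == k.2).

(** In a column, a star block contributes [2 * #|C| - 1] stars and any other block a single one. *)
Lemma lift_occurrence_system :
  occurrence_system ((2 * #|C| - 1) * Z + (#|J| - Z))%N
    lift_row lift_col lift_star.
Proof.
split.
- move=> [[[s [d d0]] t]|[[j k] /= jk]] v [[[s' [d' d0']] t']|[[j' k'] /= jk']] v' /=.
  + move=> /pair_equal_spec[rr ee] /pair_equal_spec[cc]; have [ss vv] := occ_inj sys rr cc.
    (* The column end is the row end plus the difference, so the cell determines the difference. *)
    rewrite !edge_end_negb // ee => /addrI D.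
    move: d0 ee; rewrite D => d0 /(edge_end_inj C2 d0)[tt bb].
    move: tt; rewrite vv => /addIr tt.
    split; first by rewrite ss tt (bool_irrelevance d0 d0').
    by case: v v' vv bb {rr cc} => ? ? [? ?] /= -> ->.
  + by move=> /pair_equal_spec[jj _] /pair_equal_spec[kk _]; have := occ_nonstar sys s v.1; rewrite jj kk jk'.
  + by move=> /pair_equal_spec[jj _] /pair_equal_spec[kk _]; have := occ_nonstar sys s' v'.1; rewrite -jj -kk jk.
  + move=> /pair_equal_spec[jj ->] /pair_equal_spec[kk _]; split=> //; congr inr.
    by apply: val_inj; rewrite /= jj kk.
- move=> [[[s [d d0]] t]|[[j k] /= jk]] v; rewrite /lift_star /=.
    rewrite (negbTE (occ_nonstar sys _ _)) /=; apply/eqP => /(edge_end_inj C2 d0)[_].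
    by case: v.2.
  by rewrite jk eqxx.
- move=> [j x] [k y]; rewrite /lift_star /=; case jk: (star j k) => /=.
    rewrite negbK => /eqP->.
    by exists (inr (exist _ (j, k) jk)), y.
  move=> xy; have [s [c [<- <-]]] := nonstar_occ sys (negbT jk).
  have d0 : x + y != 0 by rewrite add_eq0_char2.
  have [u [b ub]] := edge_end_surj C2 x d0.
  (* The edge [{x, y}] lies in the matching of difference [x + y]; [u - c] cancels the shift by the
     block. *)
  exists (inl (s, exist _ (x + y) d0, u - c)), (c, b) => /=.
  by rewrite subrK edge_end_negb // ub addrA prod_char2 // add0r.
- move=> [[[s [d d0]] t]|[[j k] /= jk]] v v' vv; rewrite /lift_star /=; last first.
    by rewrite jk (negbTE vv).
  (* Within one block the two cells are transposes, so the crossing cells are diagonal. *)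
  have [cc|cc] := eqVneq v.1 v'.1.
    rewrite cc (negbTE (occ_nonstar sys _ _)) /=.
    have -> : ~~ v'.2 = v.2; last by [].
    by case: v v' vv cc => c b [c' b'] /= + E; rewrite E; case: b b' => [] [] //;
      rewrite eqxx.
  (* Across blocks the crossing block comes from a star, and distinct edges are disjoint, so the
     cell is off its diagonal. *)
  rewrite (occ_blackburn sys) //=; apply/eqP => /(edge_end_inj C2 d0)[/addrI E _].
  by rewrite E eqxx in cc.
- move=> [k y].
  have -> : [set j | lift_star j (k, y)] =
      setX [set j | star j k] (~: [set y]) :|: setX (~: [set j | star j k]) [set y].
    apply/setP => -[j x]; rewrite /lift_star !inE /=.
    by case: (star j k); case: (x == y).
  rewrite cardsU !cardsX.
  have -> : setX [set j | star j k] (~: [set y]) :&: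
      setX (~: [set j | star j k]) [set y] = set0.
    apply/setP => -[j x]; rewrite !inE /=.
    by case: (star j k); case: (x == y).
  rewrite cards0 subn0 [#|~: [set y]|]cardsCs [#|~: finset _|]cardsCs !setCK cards1 (occ_stars sys) card_prod card_bool.
  by rewrite muln1 [(_ * 2)%N]mulnC [(Z * _)%N]mulnC.
Qed.

Lemma card_lift_symbol :
  #|lift_symbol| = (#|C| * (2 * #|C| - 1) * #|S| + #|K| * Z)%N.
Proof.
rewrite card_sum (card_star_cells sys) !card_prod card_sig.
have -> : #|[pred d : C * bool | d != 0]| = (2 * #|C| - 1)%N.
  have := cardC1 (0 : C * bool); rewrite card_prod card_bool mulnC subn1 => <-.
  by apply: eq_card => d; rewrite !inE.
by congr addn; rewrite mulnC -[RHS]mulnA [(#|S| * _)%N]mulnC.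
Qed.

End Lift.

(** * The symmetric starting array *)

Section Base.
Variable q : nat.

Definition pair_symbol : finType := {p : 'I_q * 'I_q | p.1 < p.2}.

Definition pair_end (s : pair_symbol) (b : bool) : 'I_q :=
  if b then (val s).1 else (val s).2.

Lemma pair_occurrence_system :
  occurrence_system 1 pair_end (fun s b => pair_end s (~~ b)) (fun j k => j == k).
Proof.
split.
- move=> [[x y] /= xy] b [[x' y'] /= xy'] b'; rewrite /pair_end.
  case: b b' => [] [] /= E E'; subst.
  + by rewrite (bool_irrelevance xy xy').
  + by have := ltn_trans xy xy'; rewrite ltnn.
  + by have := ltn_trans xy xy'; rewrite ltnn.
  + by rewrite (bool_irrelevance xy xy').
- by move=> [[x y] /= xy] []; rewrite /pair_end -val_eqE /= neq_ltn xy ?orbT.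
- move=> j k; rewrite -val_eqE neq_ltn => /orP[] jk.
    by exists (exist _ (j, k) jk), true.
  by exists (exist _ (k, j) jk), false.
- by move=> s [] [].
- move=> k; rewrite -(cards1 k); apply: eq_card => j; by rewrite !inE.
Qed.

Lemma card_pair_symbol : #|pair_symbol| = (q * (q - 1)) %/ 2.
Proof.
rewrite card_sig -sum1_card (eq_bigl (fun p : 'I_q * 'I_q => p.1 < p.2)) //.
rewrite -(pair_big_dep xpredT (fun i j : 'I_q => i < j) (fun _ _ => 1)) /=.
(* Pairs are counted by their larger element [k], which has [k] smaller partners. *)
rewrite (exchange_big_dep xpredT) //= divn2 subn1 -bin2 -bin2_sum big_mkord.
apply: eq_bigr => k _; rewrite sum1_card -[RHS]card_ord.
have winj : injective (widen_ord (ltnW (ltn_ord k))).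
  by move=> i j /(congr1 val) /= /ord_inj.
rewrite -(card_imset _ winj).
apply: eq_card => j; apply/idP/imsetP => [jk|[i _ ->]]; last exact: (ltn_ord i).
by exists (Ordinal jk) => //; apply: val_inj.
Qed.

End Base.

(** * Parameters and the induction *)

Lemma n_1 q : n_ q 1 = q.
Proof. by rewrite /n_ (mul1n (1 + 1)) divnn mul1n. Qed.

Lemma n_gt0 q i : 0 < q -> 0 < n_ q i.
Proof. by move=> q0; rewrite muln_gt0 expn_gt0. Qed.

Lemma n_S q i : 0 < i -> n_ q i.+1 = 2 ^ i.+1 * n_ q i.
Proof.
case: i => // i _; rewrite /n_ mulnA -expnD; congr (2 ^ _ * q).
(* Halving raises the exponent by [i.+2]; the truncated [- 1] stays exact because the remaining half
   is positive. *)
have -> : i.+2 * (i.+2 + 1) = i.+2 * 2 + i.+1 * (i.+1 + 1) by lia.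
by rewrite divnMDl // -addnBA // divn_gt0 //; lia.
Qed.

Lemma occurrence_system_exists q i : 0 < q -> 0 < i ->
  exists (J K S : finType) (C : finZmodType)
    (row : S -> C -> J) (col : S -> C -> K) (star : J -> K -> bool),
  [/\ occurrence_system (Z_ q i) row col star,
      forall x : C, (x + x = 0)%R,
      #|C| = 2 ^ i,
      #|J| = n_ q i /\ #|K| = n_ q i
    & #|S| = S_ q i].
Proof.
case: i => // i q0 _; elim: i => [|i [J [K [S [C [row [col [star]]]]]]]].
  exists 'I_q, 'I_q, (pair_symbol q), bool.
  exists (@pair_end q), (fun s b => pair_end s (~~ b)), (fun j k => j == k).
  split.
  - exact: pair_occurrence_system.
  - exact: addbb.
  - by rewrite card_bool.
  - by rewrite card_ord n_1.
  - exact: card_pair_symbol.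
move=> [sys C2 cC [cJ cK] cS].
exists (J * (C * bool))%type, (K * (C * bool))%type, (lift_symbol S C star),
  (C * bool)%type.
exists (@lift_row J K S C row star), (@lift_col J K S C col star), (@lift_star J K C star).
have e2 : 2 ^ i.+2 = 2 * #|C| by rewrite cC expnS.
have C0 : 0 < #|C| by rewrite cC expn_gt0.
have ZE : Z_ q i.+2 = (2 ^ i.+2 - 2) * Z_ q i.+1 + n_ q i.+1 by [].
have SE : S_ q i.+2 = (2 ^ i.+2 * (2 ^ i.+2 - 1)) %/ 2 * S_ q i.+1
  + n_ q i.+1 * Z_ q i.+1 by [].
split.
- suff -> : Z_ q i.+2 = (2 * #|C| - 1) * Z_ q i.+1 + (#|J| - Z_ q i.+1).
    exact: lift_occurrence_system.
  have /card_gt0P[k _] : 0 < #|K| by rewrite cK n_gt0.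
  (* A column has at most [#|J|] stars, so the truncated [#|J| - Z_ q i.+1] is exact and one
     [Z_ q i.+1] cancels, giving the factor [2 ^ i.+2 - 2]. *)
  have ZJ : Z_ q i.+1 <= #|J| by rewrite -(occ_stars sys k) max_card.
  have -> : 2 * #|C| - 1 = 2 * #|C| - 2 + 1 by lia.
  by rewrite ZE e2 mulnDl mul1n -addnA subnKC // cJ.
- exact: prod_char2.
- by rewrite card_prod card_bool e2 mulnC.
- by rewrite !card_prod card_bool cJ cK (n_S q (ltn0Sn i)) e2 mulnC [#|C| * 2]mulnC.
- by rewrite (card_lift_symbol sys) SE e2 cS cK -[2 * _ * _]mulnA mulKn.
Qed.

Theorem theorem26 (q r n : nat) (hr : 0 < r) (hq : 2 <= q)
    (hn : n = 2 ^ ((r * (r + 1)) %/ 2 - 1) * q) :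
  exists_regular_PDA (2 ^ r) n n (Z_ q r) (S_ q r).
Proof.
have q0 := ltnW hq; rewrite hn -/(n_ q r).
have [J [K [S [C [row [col [star [sys _ <- [cJ cK] <-]]]]]]]] :=
  occurrence_system_exists q0 hr.
rewrite -{1}cK -cJ; apply: (occurrence_system_PDA sys).
- by rewrite cJ n_gt0.
- by rewrite cK n_gt0.
- by apply/card_gt0P; exists 0%R.
Qed.
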